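(* Let $G$ be a finitely generated group, $p$ a fixed prime, and $G_{\widehat{p}}$ the pro-$p$ completion of $G$. Then $RG_p(G)=RG_p(G_{\widehat{p}})=RG(G_{\widehat{p}})$.
   Context: For an abstract group $A$, $d(A)$ is the minimal number of generators; for a profinite group, $d(A)$ is the minimal number of topological generators. Let $d_p(A)=d\big(A/[A,A]A^p\big)$. For a (topologically) finitely generated group $G$, $RG_p(G)=\inf_H\frac{d_p(H)-1}{[G:H]}$, the infimum over normal subgroups $H\trianglelefteq G$ of $p$-power index, and $RG(G)=\inf_K\frac{d(K)-1}{[G:K]}$, the infimum over finite index subgroups $K$. *)

(* Defs.v *)
From Stdlib Require Import Reals List Arith ZArith Znumtheory.
From Coquelicot Require Import Coquelicot.

Set Implicit Arguments.

(* Groups with a topology, given by their operations.                        *)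
(*   car   : ambient carrier type                                            *)
(*   gset  : the underlying set of the group inside car                      *)
(*   gnbhd : a neighbourhood basis of the identity consisting of (open)      *)
(*           normal subgroups.  An abstract group is the discrete case       *)
(*           (basis = {trivial subgroup}); a profinite group is given by a   *)
(*           basis of open normal subgroups.                                 *)
(* Group axioms are not part of the record: for the input group they are     *)
(* hypotheses of the theorem, for the pro-p completion they follow.          *)
Record GOps := {
  car :> Type;
  gset : car -> Prop;
  gmul : car -> car -> car;
  ginv : car -> car;
  gone : car;
  gnbhd : (car -> Prop) -> Prop
}.

Section GroupNotions.
Variable G : GOps.

Fixpoint gpow (x : G) (n : nat) : G :=
  match n with O => gone G | S n => gmul G (gpow x n) x end.

Definition commutator (x y : G) : G :=
  gmul G (gmul G (ginv G x) (ginv G y)) (gmul G x y).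

Definition subgroup (S : G -> Prop) : Prop :=
  (forall x, S x -> gset G x) /\ S (gone G) /\
  (forall x y, S x -> S y -> S (gmul G x y)) /\
  (forall x, S x -> S (ginv G x)).

Definition normal (H : G -> Prop) : Prop :=
  subgroup H /\
  forall g h, gset G g -> H h -> H (gmul G (gmul G (ginv G g) h) g).

Definition index (H : G -> Prop) (n : nat) : Prop :=
  exists l : list G, length l = n /\
    (forall r, In r l -> gset G r) /\
    (forall i j : nat, (i < n)%nat -> (j < n)%nat ->
       H (gmul G (ginv G (nth i l (gone G))) (nth j l (gone G))) -> i = j) /\
    (forall g, gset G g -> exists r, In r l /\ H (gmul G (ginv G r) g)).

Definition gen (A : G -> Prop) : G -> Prop :=
  fun x => forall S, subgroup S -> (forall a, A a -> S a) -> S x.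

Definition clos (A : G -> Prop) : G -> Prop :=
  fun x => gset G x /\
    forall U, gnbhd G U -> exists s, A s /\ U (gmul G (ginv G s) x).

Definition tgen (A : G -> Prop) : G -> Prop := clos (gen A).

Definition gen_by (H : G -> Prop) (n : nat) : Prop :=
  exists l : list G, length l = n /\ (forall x, In x l -> H x) /\
    (forall x, H x <-> tgen (fun y => In y l) x).

Definition d_is (H : G -> Prop) (n : nat) : Prop :=
  gen_by H n /\ forall m, gen_by H m -> (n <= m)%nat.

Definition PhiP (p : nat) (H : G -> Prop) : G -> Prop :=
  tgen (fun x => (exists a b, H a /\ H b /\ x = commutator a b) \/
                 (exists a, H a /\ x = gpow a p)).

(* H/[H,H]H^p is generated by (the images of) n elements of H *)
Definition genp_by (p : nat) (H : G -> Prop) (n : nat) : Prop :=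
  exists l : list G, length l = n /\ (forall x, In x l -> H x) /\
    (forall x, H x <-> tgen (fun y => In y l \/ PhiP p H y) x).

Definition dp_is (p : nat) (H : G -> Prop) (n : nat) : Prop :=
  genp_by p H n /\ forall m, genp_by p H m -> (n <= m)%nat.

Definition RGp_values (p : nat) : R -> Prop :=
  fun r => exists H n k, normal H /\ index H (p ^ k) /\ dp_is p H n /\
    r = (INR n - 1) / INR (p ^ k).

Definition RG_values : R -> Prop :=
  fun r => exists K n i, subgroup K /\ index K i /\ d_is K n /\
    r = (INR n - 1) / INR i.

(* subgroups with infinite d(H) contribute +oo and do not affect the inf *)
Definition RGp (p : nat) : Rbar := Glb_Rbar (RGp_values p).
Definition RG : Rbar := Glb_Rbar RG_values.

End GroupNotions.

Definition discrete (T : Type) (mul : T -> T -> T) (inv : T -> T) (one : T)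
  : GOps :=
  {| car := T; gset := fun _ => True; gmul := mul; ginv := inv; gone := one;
     gnbhd := fun U => forall x, U x <-> x = one |}.

Definition is_group (T : Type) (mul : T -> T -> T) (inv : T -> T) (one : T)
  : Prop :=
  (forall x y z, mul (mul x y) z = mul x (mul y z)) /\
  (forall x, mul one x = x) /\
  (forall x, mul (inv x) x = one).

Definition fin_gen (G : GOps) : Prop :=
  exists n, gen_by G (gset G) n.

(* Pro-p completion: inverse limit of G/N over normal subgroups N of p-power *)
(* index.  An element is a compatible family of cosets (x_N N)_N, each coset *)
(* represented as a predicate on G; topology: kernels of the projections.    *)
Section ProP.
Variables (T : Type) (mul : T -> T -> T) (inv : T -> T) (one : T) (p : nat).

Let Gd := discrete mul inv one.

Definition pnormal : Type :=
  { N : T -> Prop | normal Gd N /\ exists k, index Gd N (p ^ k) }.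

Definition pfam : Type := pnormal -> T -> Prop.

Definition pfam_set (f : pfam) : Prop :=
  (forall N : pnormal, exists g : T,
      forall z, f N z <-> proj1_sig N (mul (inv g) z)) /\
  (forall M N : pnormal, (forall x, proj1_sig M x -> proj1_sig N x) ->
      forall z, f M z -> f N z).

Definition pfam_mul (f g : pfam) : pfam :=
  fun N z => exists a b, f N a /\ g N b /\ z = mul a b.
Definition pfam_inv (f : pfam) : pfam := fun N z => f N (inv z).
Definition pfam_one : pfam := fun N => proj1_sig N.

Definition pro_p_completion : GOps :=
  {| car := pfam; gset := pfam_set; gmul := pfam_mul; ginv := pfam_inv;
     gone := pfam_one;
     gnbhd := fun U => exists N : pnormal, forall f,
        U f <-> (pfam_set f /\ forall z, f N z <-> proj1_sig N z) |}.

End ProP.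

(* Main.v *)
(** Every subgroup of [G] of [p]-power index is compared with the finite [p]-groups
[G / N], in which a proper subgroup lies in a normal subgroup of index [p]. This
gives two facts about [G]. First (Frattini), if a normal subgroup [H] of [p]-power
index is generated by a set [X] modulo [[H,H] H^p], then it is generated by [X]
modulo every [N <= H] normal of [p]-power index in [G]. Second (Schreier), descending
through steps of index [p], [d(N) - 1 <= [K : N] (d(K) - 1)], also relative to a
subgroup [F] normal in [G].

Closed subgroups of finite index of the completion are open, so they are determined
by their traces on the dense image of [G], and the normal ones of [p]-power index are
the closures [hat H] of the subgroups [H] above. Since [[H,H] H^p] has [p]-power
index ([G] being finitely generated), [d_p (H) = d_p (hat H)], and the Frattini
argument gives [d_p (H) = d (hat H)]. Hence the two [p]-gradients agree and dominate
[RG] of the completion. Conversely an open subgroup [K] contains some [hat N];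
approximating topological generators of [K] in [G] modulo [F = [N,N] N^p] and applying
Schreier relative to [F] bounds [d_p (N)] in terms of [d (K)]. *)

Require Import Defs.
From Stdlib Require Import Lia Lra List Arith.
From Stdlib Require Import Classical ClassicalEpsilon.
From Stdlib Require Import FunctionalExtensionality PropExtensionality.
From mathcomp Require all_boot all_fingroup all_solvable.
From mathcomp Require Import ssreflect.
From Stdlib Require Import Reals ZArith Znumtheory.
From Coquelicot Require Import Coquelicot.

Set Implicit Arguments.
Unset Strict Implicit.

(** * Groups given by their operations *)

Section IndexFun.
Variable G : GOps.

(** A transversal indexed by naturals below [n] can be given by a formula in the index, as in
    [pstep_index], which a list with [nth] makes awkward. *)
Lemma index_fun (H : G -> Prop) n :
  index G H n <-> exists r : nat -> G,
    (forall i, (i < n)%nat -> gset G (r i)) /\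
    (forall i j, (i < n)%nat -> (j < n)%nat ->
       H (gmul G (ginv G (r i)) (r j)) -> i = j) /\
    (forall g, gset G g -> exists i, (i < n)%nat /\ H (gmul G (ginv G (r i)) g)).
Proof.
split.
- move=> [l [<- [lG [linj lsurj]]]]; exists (fun i => nth i l (gone G)); split.
    by move=> i lti; apply: lG; apply: nth_In.
  split=> // g /lsurj [x [/(In_nth _ _ (gone G)) [i [lti <-]] Hx]].
  by exists i.
- move=> [r [rG [rinj rsurj]]]; exists (map r (seq 0 n)).
  have rE i : (i < n)%nat -> nth i (map r (seq 0 n)) (gone G) = r i.
    move=> lti; rewrite (nth_indep _ _ (r O)) ?length_map ?length_seq //.
    by rewrite map_nth seq_nth.
  rewrite length_map length_seq; split=> //; split.
    by move=> x /in_map_iff [i [<- /in_seq [_ lti]]]; apply: rG.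
  split; first by move=> i j lti ltj; rewrite !rE //; apply: rinj.
  move=> g /rsurj [i [lti Hi]]; exists (r i); split=> //.
  by apply: in_map; apply/in_seq; lia.
Qed.

End IndexFun.

Section GroupLaws.
Variables (T : Type) (mul : T -> T -> T) (inv : T -> T) (one : T).
Hypothesis hG : is_group mul inv one.
Local Infix "**" := mul (at level 40, left associativity).
Local Notation Gd := (discrete mul inv one).

Lemma gmulA x y z : (x ** y) ** z = x ** (y ** z). Proof. by case: hG. Qed.
Lemma gmul1l x : one ** x = x. Proof. by case: hG => _ []. Qed.
Lemma gmulVl x : inv x ** x = one. Proof. by case: hG => _ []. Qed.
Lemma gmulKl x y : inv x ** (x ** y) = y.
Proof. by rewrite -gmulA gmulVl gmul1l. Qed.
Lemma gmulIl x y z : x ** y = x ** z -> y = z.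
Proof. by move=> e; rewrite -(gmulKl x y) e gmulKl. Qed.
Lemma gmul1r x : x ** one = x.
Proof. by apply: (@gmulIl (inv x)); rewrite gmulKl gmulVl. Qed.
Lemma gmulVr x : x ** inv x = one.
Proof. by apply: (@gmulIl (inv x)); rewrite gmulKl gmul1r. Qed.
Lemma gmulKVl x y : x ** (inv x ** y) = y.
Proof. by rewrite -gmulA gmulVr gmul1l. Qed.
Lemma ginvK x : inv (inv x) = x.
Proof. by apply: (@gmulIl (inv x)); rewrite gmulVr gmulVl. Qed.
Lemma ginv1 : inv one = one.
Proof. by rewrite -(gmul1l (inv one)) gmulVr. Qed.
Lemma ginvM x y : inv (x ** y) = inv y ** inv x.
Proof. by apply: (@gmulIl (x ** y)); rewrite gmulVr gmulA gmulKVl gmulVr. Qed.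

(* A convergent rewriting system for the theory of groups. *)
Definition gE := (gmulA, gmul1l, gmul1r, gmulVl, gmulVr, gmulKl, gmulKVl,
  ginv1, ginvK, ginvM).

Lemma sub1 S : subgroup Gd S -> S one. Proof. by case=> _ []. Qed.
Lemma subM S x y : subgroup Gd S -> S x -> S y -> S (x ** y).
Proof. by move=> [_ [_ [h _]]]; apply: h. Qed.
Lemma subV S x : subgroup Gd S -> S x -> S (inv x).
Proof. by move=> [_ [_ [_ h]]]; apply: h. Qed.
Lemma subVE S x : subgroup Gd S -> S (inv x) -> S x.
Proof. by move=> hS h; rewrite -(ginvK x); apply: subV. Qed.
Lemma subMl S x y : subgroup Gd S -> S x -> S (x ** y) -> S y.
Proof. by move=> hS hx h; rewrite -(gmulKl x y); apply: subM => //; apply: subV. Qed.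
Lemma subMr S x y : subgroup Gd S -> S y -> S (x ** y) -> S x.
Proof.
move=> hS hy h; rewrite -(gmul1r x) -(gmulVr y) -gmulA.
by apply: subM => //; apply: subV.
Qed.
Lemma subD S x y z : subgroup Gd S -> S (inv x ** y) -> S (inv x ** z) -> S (inv y ** z).
Proof.
move=> hS hy hz; have := subM hS (subV hS hy) hz.
by rewrite !gE.
Qed.

Lemma normal_subgroup N : normal Gd N -> subgroup Gd N. Proof. by case. Qed.
Lemma normal_conj N g x : normal Gd N -> N x -> N (inv g ** x ** g).
Proof. by move=> [_ h] Nx; apply: h. Qed.
Lemma normal_conjV N g x : normal Gd N -> N x -> N (g ** x ** inv g).
Proof. by move=> hN /(normal_conj (inv g) hN); rewrite ginvK. Qed.
Lemma normal_swap N x y : normal Gd N -> N (x ** y) -> N (y ** x).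
Proof. by move=> hN /(normal_conj x hN); rewrite !gE. Qed.

Lemma gen_in (A : T -> Prop) x : A x -> gen Gd A x.
Proof. by move=> Ax S _; apply. Qed.
Lemma gen_subgroup A : subgroup Gd (gen Gd A).
Proof.
split=> //; split; first by move=> S hS _; apply: sub1.
split=> [x y hx hy|x hx] S hS hA; first by apply: subM => //; [apply: hx|apply: hy].
by apply: subV => //; apply: hx.
Qed.
Lemma gen_min (A S : T -> Prop) : subgroup Gd S -> (forall x, A x -> S x) ->
  forall x, gen Gd A x -> S x.
Proof. by move=> hS hA x; apply. Qed.
Lemma gen_mono (A B : T -> Prop) : (forall x, A x -> B x) ->
  forall x, gen Gd A x -> gen Gd B x.
Proof. by move=> AB; apply: gen_min; [apply: gen_subgroup|move=> x /AB; apply: gen_in]. Qed.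

(** The trivial subgroup is a basic neighbourhood in the discrete topology, so taking the closure
    adds nothing. *)
Lemma tgen_discrete A x : tgen Gd A x <-> gen Gd A x.
Proof.
split=> [[_ /(_ (fun y => y = one))]|hx].
  move=> /(_ (fun x => iff_refl _)) [s [hs e]].
  by rewrite -(gmulKVl s x) [inv s ** x]e gmul1r.
by split=> // U hU; exists x; split=> //; apply/hU; apply: gmulVl.
Qed.

(** * Powers of an element modulo a subgroup, and steps of index [p] *)

Local Notation pow := (gpow Gd).

Lemma powD x a b : pow x (a + b) = pow x a ** pow x b.
Proof. by elim: b => [|b IH]; rewrite ?Nat.add_0_r ?Nat.add_succ_r /= ?gmul1r // IH gmulA. Qed.
Lemma powM x a b : pow x (a * b) = pow (pow x a) b.
Proof.
elim: b => [|b IH]; first by rewrite Nat.mul_0_r.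
by rewrite Nat.mul_succ_r powD IH.
Qed.
Lemma pow_sub S x n : subgroup Gd S -> S x -> S (pow x n).
Proof. by move=> hS hx; elim: n => [|n IH] /=; [apply: sub1|apply: subM]. Qed.
Lemma powJ g x n : pow (inv g ** x ** g) n = inv g ** pow x n ** g.
Proof. by elim: n => [|n IH] /=; rewrite ?IH !gE. Qed.

Variable p : nat.
Hypothesis hp : prime (Z.of_nat p).

(** If [p] did not divide [j], a Bezout relation would express [x] through [x ^ p] and [x ^ j],
    which both lie in [S]. *)
Lemma pow_dvd S x j : subgroup Gd S -> S (pow x p) -> S (pow x j) -> ~ S x ->
  Nat.divide p j.
Proof.
move=> hS Sp Sj nS; apply: NNPP => ndv; apply: nS.
have g1 : Nat.gcd p j = 1%nat.
  have [[u eu] [v ev]] := (Nat.gcd_divide_l p j, Nat.gcd_divide_r p j).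
  have := prime_divisors _ hp (Z.of_nat (Nat.gcd p j)).
  have p2 := prime_ge_2 _ hp; case; [by exists (Z.of_nat u); lia|lia|].
  case=> // [|[|]]; [lia| |lia] => e; case: ndv; exists v.
  by rewrite {1}ev; congr Nat.mul; lia.
(* Bezout over the naturals leaves open which of [p] and [j] carries the extra 1, so this is stated
   for [a] and [b] and used in both orders. *)
have mem a b u v : (u * a = 1 + v * b)%nat -> S (pow x a) -> S (pow x b) -> S x.
  move=> e Sa Sb.
  have: S (pow x (1 + v * b)) by rewrite -e Nat.mul_comm powM; apply: pow_sub.
  rewrite powD /= gmul1l => h; apply: (@subMr _ _ (pow x (v * b))) => //.
  by rewrite Nat.mul_comm powM; apply: pow_sub.
by have := Nat.gcd_bezout p j; rewrite g1 => -[] [u [v e]]; apply: (mem _ _ _ _ e).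
Qed.

Lemma pow_inj S x a b : subgroup Gd S -> S (pow x p) -> ~ S x ->
  (a < p)%nat -> (b < p)%nat -> S (inv (pow x a) ** pow x b) -> a = b.
Proof.
move=> hS Sp nS.
have main c d : (c <= d)%nat -> (d < p)%nat -> S (inv (pow x c) ** pow x d) -> c = d.
  move=> lecd ltd; have -> : d = (c + (d - c))%nat by lia.
  rewrite powD gmulKl => /(pow_dvd hS Sp) /(_ nS) [[|z] e]; nia.
move=> lta ltb h; have [le|le] := Nat.le_ge_cases a b; first exact: main.
by symmetry; apply: main => //; have := subV hS h; rewrite !gE.
Qed.

(* [K / M] is cyclic of order [p], generated by the class of [x]. *)
Definition pstep (K M : T -> Prop) x :=
  subgroup Gd K /\ subgroup Gd M /\ (forall z, M z -> K z) /\ K x /\ ~ M x /\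
  M (pow x p) /\ (forall m, M m -> M (inv x ** m ** x)) /\
  forall k, K k -> exists j, M (inv (pow x j) ** k).

Lemma pstep_index K M x i : pstep K M x -> index Gd K i -> index Gd M (i * p).
Proof.
move=> [hK [hM [MK [Kx [nMx [Mp [_ surj]]]]]]] /index_fun [r [_ [rinj rsurj]]].
have p2 : (2 <= p)%nat by have := prime_ge_2 _ hp; lia.
(* The index [a < i * p] encodes a pair: its quotient by [p] picks a coset of [K], its remainder a
   power of [x]. *)
apply/index_fun; exists (fun a => r (a / p)%nat ** pow x (a mod p)); split=> //; split.
- move=> a b lta ltb /=; rewrite !gE => Mab.
  have lt c : (c < i * p -> c / p < i)%nat.
    by move=> h; apply: Nat.Div0.div_lt_upper_bound; lia.
  have eab : (a / p = b / p)%nat.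
    apply: rinj; [exact: lt|exact: lt|].
    have := subMl hK (subV hK (pow_sub (a mod p) hK Kx)) (MK _ Mab).
    by rewrite -gmulA; apply: subMr => //; apply: pow_sub.
  rewrite (Nat.div_mod_eq a p) (Nat.div_mod_eq b p) eab; congr (_ + _)%nat.
  move: Mab; rewrite eab !gE; apply: pow_inj => //; apply: Nat.mod_upper_bound; lia.
- move=> g _; have [a [lta Ka]] := rsurj g I; have [j Mj] := surj _ Ka.
  exists (a * p + j mod p)%nat; have ltj := Nat.mod_upper_bound j p.
  split; first nia.
  rewrite Nat.div_add_l ?Nat.div_small ?Nat.add_0_r; try lia.
  rewrite Nat.add_comm Nat.Div0.mod_add Nat.Div0.mod_mod /= !gE.
  (* The exponent [j] may be reduced modulo [p], because the remaining factor is a power of [x ^ p]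
     and lies in [M]. *)
  move: Mj; rewrite {1}(Nat.div_mod_eq j p) Nat.add_comm powD powM !gE /=.
  by apply: subMl => //; apply: subV => //; apply: pow_sub.
Qed.

(** Send each coset of [K] to the coset of [N] containing its representative. As [N] lies in [K]
    this map is injective, and the pigeonhole principle applies. *)
Lemma index_le N K q i : subgroup Gd K -> (forall x, N x -> K x) ->
  index Gd N q -> index Gd K i -> (i <= q)%nat.
Proof.
move=> hK NK /index_fun [s [_ [_ ssurj]]] /index_fun [r [_ [rinj _]]].
have ex a : exists b, (b < q)%nat /\ N (inv (s b) ** r a) by apply: ssurj.
have [f fP] : exists f, forall a, (f a < q)%nat /\ N (inv (s (f a)) ** r a).
  exists (fun a => proj1_sig (constructive_indefinite_description _ (ex a))) => a.
  by case: constructive_indefinite_description.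
have := @NoDup_incl_length _ (map f (seq 0 i)) (seq 0 q).
rewrite length_map !length_seq; apply.
- apply: NoDup_map_NoDup_ForallPairs; last exact: seq_NoDup.
  move=> a b /in_seq [_ lta] /in_seq [_ ltb] e; apply: rinj => //.
  have [_ ha] := fP a; have [_ hb] := fP b; rewrite -e in hb.
  by have := subV hK (subD hK (NK _ hb) (NK _ ha)); rewrite !gE.
- by move=> b /in_map_iff [a [<- _]]; apply/in_seq; have [] := fP a; lia.
Qed.

End GroupLaws.

(** * Finite p-quotients *)

Module CosetAction.
Import all_boot all_fingroup all_solvable.
Import GroupScope.

Lemma prime_natE (p : nat) : Znumtheory.prime (Z.of_nat p) -> prime p.
Proof.
move=> hp; have p2 := prime_ge_2 _ hp.
apply/primeP; split; first by apply/ltP; lia.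
move=> d /dvdnP [k e].
have: Z.divide (Z.of_nat d) (Z.of_nat p) by exists (Z.of_nat k); rewrite e -multE Nat2Z.inj_mul.
case/(prime_divisors _ hp) => [|[|[|]]] h; apply/orP; [lia|left|right|lia].
  by apply/eqP; lia.
by apply/eqP; lia.
Qed.

Lemma expn_pow p k : Nat.pow p k = expn p k.
Proof. by elim: k => //= k ->; rewrite expnS. Qed.

(** * The quotient by [N] as a permutation group on its left cosets *)

Section Action.
Variables (T : Type) (mul : T -> T -> T) (inv : T -> T) (one : T).
Hypothesis hG : is_group mul inv one.
Local Infix "**" := mul (at level 40, left associativity).
Local Notation Gd := (discrete mul inv one).
Local Notation gE := (gE hG).
Variables (N : T -> Prop) (n : nat) (r : nat -> T).
Hypothesis hN : Defs.normal Gd N.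
Hypothesis rinj : forall i j, (i < n)%coq_nat -> (j < n)%coq_nat ->
  N (inv (r i) ** r j) -> i = j.
Hypothesis rsurj : forall g, exists i, (i < n)%coq_nat /\ N (inv (r i) ** g).

Let hNs := normal_subgroup hN.

Lemma coset_ex g : exists i : 'I_n, N (inv (r i) ** g).
Proof. by have [i [/ltP lti h]] := rsurj g; exists (Ordinal lti). Qed.

Definition cidx g : 'I_n := proj1_sig (constructive_indefinite_description _ (coset_ex g)).

Lemma cidxP g : N (inv (r (cidx g)) ** g).
Proof. by rewrite /cidx; case: constructive_indefinite_description. Qed.

Lemma cidx_eq g h : N (inv g ** h) -> cidx g = cidx h.
Proof.
move=> Ngh; apply: ord_inj; apply: rinj; try exact/ltP/ltn_ord.
have := subM hNs (subM hNs (cidxP g) Ngh) (subV hNs (cidxP h)).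
by rewrite !gE.
Qed.

Lemma cidx_inj g h : cidx g = cidx h -> N (inv g ** h).
Proof. by move=> e; apply: (subD hG hNs (cidxP g)); rewrite e; apply: cidxP. Qed.

Lemma caction_inj g : injective (fun i : 'I_n => cidx (inv g ** r i)).
Proof.
move=> i j /cidx_inj; rewrite !gE => h; apply: ord_inj.
by apply: rinj => //; apply/ltP.
Qed.

(* [g] acts by [inv g] on left cosets since permutations compose from left to right. *)
Definition caction g : 'S_n := perm (@caction_inj g).

Lemma cactionM g h : caction (g ** h) = caction g * caction h.
Proof.
apply/permP => i; rewrite permM !permE; apply: cidx_eq.
rewrite !gE.
have := subV hNs (cidxP (inv g ** r i)); by rewrite !gE.
Qed.

Lemma caction_eq g h : N (inv g ** h) -> caction g = caction h.
Proof.
move=> Ngh; apply/permP => i; rewrite !permE; apply: cidx_eq; rewrite !gE.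
by have := normal_conj (r i) hN (subV hNs (normal_conjV hG g hN Ngh)); rewrite !gE.
Qed.

(** The action is faithful modulo [N]: comparing both permutations at the coset of [one] already
    suffices, since [N] is normal. *)
Lemma caction_ker g h : caction g = caction h -> N (inv g ** h).
Proof.
move=> /permP /(_ (cidx one)); rewrite !permE => /cidx_inj; set x := r _ => h1.
have := normal_conjV hG x hN h1; rewrite !gE => h2.
by have := subV hNs (normal_swap hG hN h2); rewrite !gE.
Qed.

Lemma caction1 : caction one = 1.
Proof. by apply: (mulgI (caction one)); rewrite -cactionM gE mulg1. Qed.

Lemma cactionV g : caction (inv g) = (caction g)^-1.
Proof. by apply: (mulgI (caction g)); rewrite -cactionM mulgV !gE caction1. Qed.

Lemma cactionX g j : caction (gpow Gd g j) = caction g ^+ j.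
Proof. by elim: j => [|j IH] /=; rewrite ?caction1 // cactionM IH expgSr. Qed.

(** Only the finitely many representatives [r i] are tested, with excluded middle supplying a
    boolean. When [K] contains [N] this is the full image of [K]. *)
Definition cimage (K : T -> Prop) : {set 'S_n} :=
  [set caction (r i) | i : 'I_n & (if excluded_middle_informative (K (r i)) then true else false)].

Lemma cimageP (K : T -> Prop) g : Defs.subgroup Gd K -> (forall x, N x -> K x) ->
  (caction g \in cimage K) <-> K g.
Proof.
move=> hK NK; split.
  case/imsetP => i; rewrite inE; case: excluded_middle_informative => // Ki _ e.
  have /NK := caction_ker (esym e); exact: (subMl hG hK (subV hK Ki)).
move=> Kg; apply/imsetP; exists (cidx g); last first.
  by apply: caction_eq; have := subV hNs (cidxP g); rewrite !gE.
rewrite inE; case: excluded_middle_informative => // -[].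
have := subM hK Kg (subV hK (NK _ (cidxP g))); by rewrite !gE.
Qed.

Lemma cimage_ex K s : s \in cimage K -> exists2 g, K g & s = caction g.
Proof.
case/imsetP => i; rewrite inE; case: excluded_middle_informative => // Ki _ ->.
by exists (r i).
Qed.

Lemma cimage_group_set K : Defs.subgroup Gd K -> (forall x, N x -> K x) ->
  group_set (cimage K).
Proof.
move=> hK NK; apply/group_setP; split.
  by rewrite -caction1; apply/cimageP => //; apply: sub1 hK.
move=> x y /cimage_ex [g Kg ->] /cimage_ex [h Kh ->].
by rewrite -cactionM; apply/cimageP => //; apply: subM.
Qed.

Lemma card_cimageT : #|cimage (fun _ => True)| = n.
Proof.
rewrite card_imset.
  rewrite -[RHS]card_ord; apply: eq_card => i; rewrite inE.
  by case: excluded_middle_informative => // -[].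
move=> i j /caction_ker h; apply: ord_inj.
by apply: rinj => //; apply/ltP.
Qed.

End Action.

(* A proper subgroup of a finite [p]-group lies in a normal subgroup of index
   [p]; here for the [p]-group [G / N]. *)
Lemma maximal_overgroup (T : Type) (mul : T -> T -> T) (inv : T -> T) (one : T)
    (p k : nat) (N A K : T -> Prop) (Gd := discrete mul inv one) :
  is_group mul inv one -> Znumtheory.prime (Z.of_nat p) ->
  Defs.normal Gd N -> Defs.index Gd N (Nat.pow p k) ->
  Defs.subgroup Gd A -> Defs.subgroup Gd K ->
  (forall x, N x -> A x) -> (forall x, A x -> K x) -> ~ (forall x, K x -> A x) ->
  exists M, Defs.subgroup Gd M /\ (forall x, A x -> M x) /\ (forall x, M x -> K x) /\
    (exists y, K y /\ ~ M y) /\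
    (forall y, K y -> ~ M y -> pstep mul inv one p K M y) /\
    (forall a b, K a -> K b -> M (Defs.commutator Gd a b)).
Proof.
move=> hG /[dup] hp /prime_natE pp hN; move en: (Nat.pow p k) => n.
move=> /index_fun [r [_ [rinj rsurj0]]] hA hK NA AK nKA.
have rsurj g : exists i, (i < n)%coq_nat /\ N (mul (inv (r i)) g) by apply: rsurj0.
have NK x : N x -> K x by move/NA/AK.
pose phi := caction hG hN rinj rsurj.
pose im := cimage hG hN rinj rsurj.
pose GT := Group (cimage_group_set hG hN rinj rsurj (K := fun _ => True)
   ltac:(by []) ltac:(by [])).
pose GK := Group (cimage_group_set hG hN rinj rsurj hK NK).
pose GA := Group (cimage_group_set hG hN rinj rsurj hA NA).
have pT : p.-group GT.
  by rewrite /pgroup card_cimageT -en expn_pow pnatX pnat_id.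
have inT g : phi g \in GT by apply/cimageP.
have inK g : (phi g \in GK) <-> K g by exact: cimageP.
have inA g : (phi g \in GA) <-> A g by exact: cimageP.
have exK s : s \in GK -> exists2 g, K g & s = phi g by exact: cimage_ex.
have exA s : s \in GA -> exists2 g, A g & s = phi g by exact: cimage_ex.
have pK : p.-group GK.
  by apply: pgroupS pT; apply/subsetP => s /exK [g _ ->]; apply: inT.
have sAK : GA \subset GK.
  by apply/subsetP => s /exA [g Ag ->]; apply/inK/AK.
(* A maximal subgroup of a finite [p]-group is normal of index [p]; its preimage is the required
   subgroup. *)
have [eAK|[M maxM sAM]] := maximal_exists sAK.
  by case: nKA => x Kx; apply/inA; rewrite eAK; apply/inK.
have nMK := p_maximal_normal pK maxM.
have sMK := normal_sub nMK.
have iMK := p_maximal_index pK maxM.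
have cKM : #|GK / M| = p by rewrite card_quotient ?normal_norm.
have phiM g h : phi (mul g h) = phi g * phi h by apply: cactionM.
have phiV g : phi (inv g) = (phi g)^-1 by apply: cactionV.
have phiX g j : phi (gpow Gd g j) = phi g ^+ j by apply: cactionX.
have hM : Defs.subgroup Gd (fun x => phi x \in M).
  split=> //; split; first by rewrite /phi /= caction1 group1.
  split=> [x y hx hy|x hx] /=; first by rewrite phiM groupM.
  by rewrite phiV groupV.
exists (fun x => phi x \in M); split=> //; split.
  by move=> x /inA h; apply: (subsetP sAM).
split; first by move=> x h; apply/inK/(subsetP sMK).
(* The quotient by [M] has prime order, so the class of any element outside [M] generates it. *)
have gen1 y : K y -> phi y \notin M -> <[coset M (phi y)]> = GK / M.
  move=> /inK Ky nMy; apply/eqP; rewrite eqEcard cycle_subG mem_quotient //=.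
  rewrite cKM dvdn_leq ?order_gt0 //.
  have /primeP [_ /(_ #[coset M (phi y)])] := pp.
  have dvo : #[coset M (phi y)] %| p.
    by have := order_dvdG (mem_quotient M Ky); rewrite cKM.
  move=> /(_ dvo) /orP [|/eqP o]; last by rewrite -orderE o.
  rewrite order_eq1 => /eqP e1.
  by have := coset_idr (subsetP (normal_norm nMK) _ Ky) e1; rewrite (negPf nMy).
split.
  have /subsetPn [s /exK [g Kg es] nMs] := proper_subn (maxgroupp maxM).
  by rewrite es in nMs; exists g; split=> //; apply/negP.
split; last first.
  move=> a b /inK Ka /inK Kb; rewrite /commutator /= !phiM !phiV.
  have abKM : abelian (GK / M) by rewrite cyclic_abelian // prime_cyclic ?cKM.
  have : GK^`(1) \subset M by apply: der1_min (normal_norm nMK) _.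
  move/subsetP; apply; have := mem_commg Ka Kb; by rewrite /commg /conjg !mulgA.
move=> y Ky /negP nMy; split=> //; split=> //; split.
  by move=> x h; apply/inK/(subsetP sMK).
split=> //; split; first exact/negP.
have Ky' := Ky; move/inK in Ky'.
have nMy' := subsetP (normal_norm nMK) _ Ky'.
split.
  rewrite phiX; apply: coset_idr; first by rewrite groupX.
  by rewrite morphX // -cKM -(gen1 y) // -orderE expg_order.
split.
  move=> m Mm /=; rewrite !phiM phiV -mulgA -/(conjg _ _).
  by rewrite memJ_norm.
move=> x /inK Kx; have nMx := subsetP (normal_norm nMK) _ Kx.
have : coset M (phi x) \in <[coset M (phi y)]> by rewrite gen1 // mem_quotient.
case/cycleP => j ej; exists j; rewrite phiM phiV phiX.
apply: coset_idr; first by rewrite groupM ?groupV ?groupX.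
by rewrite morphM ?groupV ?groupX // morphV ?groupX // morphX //= ej mulVg.
Qed.

End CosetAction.

(** * Subgroups of p-power index *)

Lemma pred_ext (T : Type) (P Q : T -> Prop) : (forall x, P x <-> Q x) -> P = Q.
Proof.
by move=> PQ; apply: functional_extensionality => x; apply: propositional_extensionality.
Qed.

Section PPowerIndex.
Variables (T : Type) (mul : T -> T -> T) (inv : T -> T) (one : T).
Hypothesis hG : is_group mul inv one.
Local Infix "**" := mul (at level 40, left associativity).
Local Notation Gd := (discrete mul inv one).
Local Notation gE := (gE hG).
Local Notation pow := (gpow Gd).
Local Notation gen := (gen Gd).
Local Notation sub1 := (@sub1 _ mul inv one _).
Local Notation subM := (@subM _ mul inv one _ _ _).
Local Notation subV := (@subV _ mul inv one _ _).
Local Notation gen_in := (@gen_in _ mul inv one _ _).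
Local Notation gen_min := (@gen_min _ mul inv one _ _).
Local Notation gen_mono := (@gen_mono _ mul inv one _ _).
Local Notation normal_conj := (@normal_conj _ mul inv one _).
Variable p : nat.
Hypothesis hp : prime (Z.of_nat p).
Local Notation pstep := (pstep mul inv one p).
Local Notation Phi := (PhiP Gd p).

Definition pnorm (N : T -> Prop) := normal Gd N /\ exists k, index Gd N (Nat.pow p k).

Lemma p_gt1 : (2 <= p)%nat.
Proof. by have := prime_ge_2 _ hp; lia. Qed.

Lemma subgroupT : subgroup Gd (fun _ => True). Proof. by []. Qed.

Lemma indexT : index Gd (fun _ => True) 1.
Proof.
apply/index_fun; exists (fun _ => one); split=> //; split=> [i j|g _]; first by lia.
by exists O; split=> //; lia.
Qed.

Lemma index_gt0 H i : index Gd H i -> (0 < i)%nat.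
Proof. by move=> /index_fun [r [_ [_ /(_ one I) [a [lta _]]]]]; lia. Qed.

Lemma index_unique H i j : subgroup Gd H -> index Gd H i -> index Gd H j -> i = j.
Proof.
move=> hH hi hj; have h1 := index_le hG hH (fun _ h => h) hi hj.
by have h2 := index_le hG hH (fun _ h => h) hj hi; lia.
Qed.

(** An induction principle: as long as [K] differs from [N], [maximal_overgroup] with [A = N]
    inserts a subgroup of index [p] in [K]. The index grows at each step and is bounded by that of
    [N]. *)
Lemma pstep_chain (N : T -> Prop) (P : (T -> Prop) -> Prop) :
  pnorm N ->
  (forall K M, subgroup Gd K -> subgroup Gd M ->
     (forall x, N x -> M x) -> (forall x, M x -> K x) ->
     (exists y, K y /\ ~ M y) -> (forall y, K y -> ~ M y -> pstep K M y) ->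
     P K -> P M) ->
  forall K i, subgroup Gd K -> (forall x, N x -> K x) -> index Gd K i -> P K -> P N.
Proof.
move=> [hN [k iN]] step K i; have [d led] : exists d, (Nat.pow p k - i <= d)%nat by eexists.
elim: d K i led => [|d IH] K i led hK NK iK PK.
all: have [KN|nKN] := classic (forall x, K x -> N x);
  first by rewrite -(@pred_ext _ K N) // => x; split; [apply: KN|apply: NK].
all: have [M [hM [NM [MK [[y [Ky nMy]] [st _]]]]]] :=
  CosetAction.maximal_overgroup hG hp hN iN (normal_subgroup hN) hK (fun _ h => h) NK nKN.
all: have iM := pstep_index hG hp (st y Ky nMy) iK.
(* With [d = 0] the bound [i * p <= p ^ k <= i] is absurd, as [p >= 2] and [i > 0]; otherwise the
   gap between [p ^ k] and the index has shrunk. *)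
all: have := index_le hG hM NM iN iM; have := index_gt0 iK; have := p_gt1 => p2 i0 le.
  by nia.
apply: (IH M (i * p)%nat) => //; first by nia.
by apply: (step K) => //; exists y.
Qed.

Lemma subgroup_inter N M : subgroup Gd N -> subgroup Gd M ->
  subgroup Gd (fun x => N x /\ M x).
Proof.
move=> hN hM; split=> //; split; first by split; [apply: sub1 hN|apply: sub1 hM].
split=> [x y [? ?] [? ?]|x [? ?]]; split; by [apply: subM|apply: subV].
Qed.

Lemma normal_inter N M : normal Gd N -> normal Gd M -> normal Gd (fun x => N x /\ M x).
Proof.
move=> [hN cN] [hM cM]; split; first exact: subgroup_inter.
by move=> g h _ [Nh Mh]; split; [apply: cN|apply: cM].
Qed.

(** Descend from the whole group to [M] by steps of index [p]. Intersecting a step with [N] gives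
    either equality or again a step of index [p], so the index of the intersection stays a power of
    [p]. *)
Lemma pnorm_inter N M : pnorm N -> pnorm M -> pnorm (fun x => N x /\ M x).
Proof.
move=> [hN [k iN]] hM; split; first by apply: normal_inter => //; case: hM.
have hNs := normal_subgroup hN.
apply: (pstep_chain (P := fun K => exists j, index Gd (fun x => N x /\ K x) (Nat.pow p j)) hM)
  (subgroupT) _ indexT _ => //; last first.
  by exists k; rewrite (@pred_ext _ (fun x => N x /\ True) N) // => x; split=> [[]|].
move=> K L hK hL _ LK _ st [j ij].
have [[y [Ny [Ky nLy]]]|no] := classic (exists y, N y /\ K y /\ ~ L y); last first.
  exists j; rewrite -(@pred_ext _ (fun x => N x /\ K x) (fun x => N x /\ L x)) // => x.
  split=> -[Nx h]; split=> //; last exact: LK.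
  by apply: NNPP => nLx; apply: no; exists x.
exists (S j); rewrite /= Nat.mul_comm; apply: (pstep_index hG hp (x := y)) ij.
have [_ [_ [_ [_ [_ [yp [conj surj]]]]]]] := st y Ky nLy.
split; first exact: subgroup_inter.
split; first exact: subgroup_inter.
split; first by move=> z [? ?]; split=> //; apply: LK.
split=> //; split; first by case.
split; first by split=> //; apply: pow_sub.
split; first by move=> m [Nm Lm]; split; [exact: (normal_conj _ hN Nm)|exact: conj].
move=> x [Nx Kx]; have [c hc] := surj x Kx; exists c; split=> //.
by apply: subM => //; apply: subV => //; apply: pow_sub.
Qed.

(** * Multiplying a subgroup by the powers of an element normalising it *)

Section PowerCosets.
Variables (S : T -> Prop) (x : T).
Hypothesis hS : subgroup Gd S.
Hypothesis conj : forall m, S m -> S (inv x ** m ** x).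

Lemma pow_conj m a : S m -> S (inv (pow x a) ** m ** pow x a).
Proof.
move=> Sm; elim: a => [|a IH] /=; first by rewrite !gE.
by have := conj IH; rewrite !gE.
Qed.

Hypothesis Sp : S (pow x p).

Lemma pow_mult_in a : S (pow x (p * a)).
Proof. by rewrite powM //; apply: pow_sub. Qed.

Lemma pow_cosets_subgroup : subgroup Gd (fun k => exists j, S (inv (pow x j) ** k)).
Proof.
split=> //; split; first by exists O; rewrite /= !gE; apply: sub1 hS.
split=> [k1 k2 [i hi] [j hj]|k [i hi]].
  exists (i + j)%nat; have := subM hS (pow_conj j hi) hj.
  by rewrite powD // !gE.
(* Exponents are naturals, so [x ^ (i * (p - 1))] stands in for the inverse of [x ^ i]; they differ
   by [x ^ (p * i)], which lies in [S]. *)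
have [q qE] : exists q, p = (1 + q)%nat by exists (p - 1)%nat; have := p_gt1; lia.
exists (i * q)%nat; have := subM hS (pow_conj (i * q) (subV hS hi)).
move=> /(_ (inv (pow x (i + i * q)))); rewrite powD // !gE; apply.
rewrite -(ginvM hG) -(powD hG); apply: subV => //.
have -> : (i + i * q = p * i)%nat by nia.
exact: pow_mult_in.
Qed.

End PowerCosets.

Lemma powSl x a : pow x (S a) = x ** pow x a.
Proof. by rewrite -Nat.add_1_l (powD hG) /= (gmul1l hG). Qed.

(* If [z] generates [K] modulo [M], replace every other generator [w] by a
   representative in [M] of its class modulo the powers of [z]; then [z ^ p] and
   the conjugates of these representatives by [1, z, .., z ^ (p - 1)] generate [M]. *)
Lemma schreier_step K M F (l : list T) : subgroup Gd M ->
  (exists y, K y /\ ~ M y) -> (forall y, K y -> ~ M y -> pstep K M y) ->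
  normal Gd F -> (forall x, F x -> M x) ->
  (forall x, K x <-> gen (fun z => In z l \/ F z) x) ->
  exists l' : list T, (length l' + p = p * length l + 1)%nat /\
    forall x, M x <-> gen (fun z => In z l' \/ F z) x.
Proof.
move=> hM [y [Ky nMy]] st hF FM Kgen.
have hFs := normal_subgroup hF.
(* If all of [l] lay in [M], then so would [K], since [F] does. *)
have [z [lz nMz]] : exists z, In z l /\ ~ M z.
  apply: NNPP => no; apply: nMy; move/Kgen: Ky; apply: gen_min => // x [lx|]; last exact: FM.
  by apply: NNPP => nMx; apply: no; exists x.
have Kin x : In x l -> K x by move=> lx; apply/Kgen; apply: gen_in; left.
have stz := st z (Kin z lz) nMz.
have [hK [_ [MK [_ [_ [zp [conj surj]]]]]]] := stz.
have [l1 [l2 lE]] := in_split z l lz; pose L : list T := l1 ++ l2.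
have inL w : In w l <-> w = z \/ In w L.
  by rewrite lE /L !in_app_iff /=; intuition.
have lenL : length l = S (length L) by rewrite lE /L !length_app /=; lia.
have [f fP] : exists f : T -> nat, forall w, K w -> M (inv (pow z (f w)) ** w).
  have ex w : exists j, K w -> M (inv (pow z j) ** w).
    have [Kw|nKw] := classic (K w); last by exists O.
    by have [j hj] := surj w Kw; exists j.
  exists (fun w => proj1_sig (constructive_indefinite_description _ (ex w))) => w.
  by case: constructive_indefinite_description.
pose m w := inv (pow z (f w)) ** w.
pose cj a w := inv (pow z a) ** m w ** pow z a.
(* The list has [1 + p * length L] entries and [length l = length L + 1]. The claimed length
   equation is this count without subtraction. *)
pose l' := pow z p :: flat_map (fun a => map (cj a) L) (seq 0 p).
exists l'; split.
  rewrite lenL /= (flat_map_constant_length (c := length L)) ?length_seq;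
    first by rewrite Nat.mul_succ_r; lia.
  by move=> a _; rewrite length_map.
pose M' := gen (fun x => In x l' \/ F x).
have hM' : subgroup Gd M' by apply: gen_subgroup.
have M'zp : M' (pow z p) by apply: gen_in; left; left.
have M'F x : F x -> M' x by move=> Fx; apply: gen_in; right.
have M'cj a w : (a < p)%nat -> In w L -> M' (cj a w).
  move=> lta Lw; apply: gen_in; left; right; apply/in_flat_map; exists a.
  by split; [apply/in_seq; lia|apply: in_map].
have p2 := p_gt1.
have M'm w : In w L -> M' (m w).
  by move=> Lw; have := M'cj 0%nat w; rewrite /cj /= !gE; apply=> //; lia.
have M'M x : M' x -> M x.
  apply: gen_min => // {}x [[<-//|/in_flat_map [a [_ /in_map_iff [w [<- Lw]]]]]|]; last exact: FM.
  by apply: pow_conj => //; apply: fP; apply: Kin; apply/inL; right.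
(* Conjugation by [z] sends [cj a w] to [cj (a + 1) w]. At [a = p - 1] it wraps around to [m w]
   conjugated by [z ^ p], and both of these lie in [M']. *)
have conj' x : M' x -> M' (inv z ** x ** z).
  move/(_ (fun x => M' (inv z ** x ** z))); apply.
    split=> //; split; first by rewrite !gE; apply: sub1 hM'.
    split=> [u v hu hv|u hu].
      by have := subM hM' hu hv; rewrite /= !gE.
    by have := subV hM' hu; rewrite /= !gE.
  move=> {}x [[<-|/in_flat_map [a [/in_seq [_ lta] /in_map_iff [w [<- Lw]]]]]|Fx].
  - by have := powSl z p; rewrite /= => e; rewrite (gmulA hG) e !gE.
  - have -> : inv z ** cj a w ** z = cj (S a) w by rewrite /cj /= !gE.
    have [lt|ge] := Nat.lt_ge_cases (S a) p; first exact: M'cj.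
    have -> : S a = p by lia.
    by apply: (subM hM' (subM hM' (subV hM' M'zp) (M'm w Lw)) M'zp).
  - by apply: M'F; apply: (normal_conj _ hF).
move=> x; split=> [Mx|]; last exact: M'M.
(* The cosets [z ^ j M'] together exhaust [K]. If the element lies in [M], so does [z ^ j]; then [p]
   divides [j] and [z ^ j] is in [M']. *)
have hS := pow_cosets_subgroup hM' conj' M'zp.
have [j hj] : exists j, M' (inv (pow z j) ** x).
  move/MK/Kgen: Mx; apply: gen_min hS _ x => w [/inL [->|Lw]|Fw].
  - by exists 1%nat; rewrite /= !gE; apply: sub1 hM'.
  - by exists (f w); apply: M'm.
  - by exists O; rewrite /= !gE; apply: M'F.
have Mj : M (pow z j) by apply: subVE hM (subMr hG hM Mx (M'M _ hj)).
have [c jE] := pow_dvd hG hp hM zp Mj nMz.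
have M'j : M' (pow z j) by rewrite jE Nat.mul_comm; apply: pow_mult_in.
by have := subM hM' M'j hj; rewrite gE.
Qed.

(* The Schreier index inequality, multiplied by [i], relative to [F]. *)
Lemma schreier N k F K i (l : list T) :
  normal Gd N -> index Gd N (Nat.pow p k) ->
  normal Gd F -> (forall x, F x -> N x) ->
  subgroup Gd K -> (forall x, N x -> K x) -> index Gd K i ->
  (forall x, K x <-> gen (fun z => In z l \/ F z) x) ->
  exists l' : list T, (forall x, N x <-> gen (fun z => In z l' \/ F z) x) /\
    (i * length l' + Nat.pow p k <= Nat.pow p k * length l + i)%nat.
Proof.
move=> hN iN hF FN hK NK iK Kgen.
have [i' [l' [iN' [Ngen le]]]] : exists i' (l' : list T), index Gd N i' /\
    (forall x, N x <-> gen (fun z => In z l' \/ F z) x) /\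
    (i * length l' + i' <= i' * length l + i)%nat.
  (* The invariant says that [(length l' - 1) / i'] is at most [(length l - 1) / i]. A step of index
     [p] multiplies both [length l' - 1] and [i'] by [p]. *)
  apply: (pstep_chain (P := fun K' => exists i' (l' : list T), index Gd K' i' /\
    (forall x, K' x <-> gen (fun z => In z l' \/ F z) x) /\
    (i * length l' + i' <= i' * length l + i)%nat) _ _ hK NK iK _).
  - by split=> //; exists k.
  - move=> K' M hK' hM NM MK' ex st [i' [l' [iK' [K'gen le]]]].
    have [l'' [len'' Mgen]] := schreier_step hM ex st hF (fun x h => NM _ (FN _ h)) K'gen.
    have [y [K'y nMy]] := ex.
    exists (i' * p)%nat, l''; split; first exact: (pstep_index hG hp (st y K'y nMy) iK').
    split=> //; nia.
  - by exists i, l; split; [exact: iK|split; [exact: Kgen|lia]].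
by exists l'; split=> //; rewrite -(index_unique (normal_subgroup hN) iN' iN).
Qed.

(** * The subgroup [[H,H] H^p] and generation modulo it *)

Section Frattini.
Variable H : T -> Prop.
Hypothesis hH : subgroup Gd H.

Lemma Phi_gen x : Phi H x <-> gen (fun x => (exists a b, H a /\ H b /\ x = commutator Gd a b) \/
   (exists a, H a /\ x = pow a p)) x.
Proof. exact: tgen_discrete. Qed.

Lemma Phi_subgroup : subgroup Gd (Phi H).
Proof. by rewrite (pred_ext Phi_gen); apply: gen_subgroup. Qed.

Lemma Phi_commutator a b : H a -> H b -> Phi H (commutator Gd a b).
Proof. by move=> Ha Hb; apply/Phi_gen; apply: gen_in; left; exists a, b. Qed.

Lemma Phi_pow a : H a -> Phi H (pow a p).
Proof. by move=> Ha; apply/Phi_gen; apply: gen_in; right; exists a. Qed.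

Lemma Phi_min (S : T -> Prop) : subgroup Gd S ->
  (forall a b, H a -> H b -> S (commutator Gd a b)) -> (forall a, H a -> S (pow a p)) ->
  forall x, Phi H x -> S x.
Proof.
move=> hS hc hpw x /Phi_gen; apply: gen_min => // {}x [[a [b [Ha [Hb ->]]]]|[a [Ha ->]]].
  exact: hc.
exact: hpw.
Qed.

Lemma Phi_sub x : Phi H x -> H x.
Proof.
apply: Phi_min => // [a b Ha Hb|a Ha]; last exact: pow_sub.
by apply: subM => //; apply: subM => //; apply: subV.
Qed.


(** Modulo [Phi H] the group is elementary abelian, so dropping one generator either changes nothing
    or passes to a subgroup of index [p]. Dropping all of them leaves [Phi H]. *)
Lemma gen_Phi_index (l : list T) k : (forall x, In x l -> H x) ->
  index Gd (gen (fun z => In z l \/ Phi H z)) (Nat.pow p k) ->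
  exists j, index Gd (Phi H) (Nat.pow p j).
Proof.
elim: l k => [|x l IH] k.
  move=> _ iP; exists k.
  rewrite -(@pred_ext _ (gen (fun z => In z nil \/ Phi H z)) (Phi H)) // => x.
  split; last by move=> h; apply: gen_in; right.
  by apply: gen_min; [apply: Phi_subgroup|move=> z []].
move=> lH; set K := gen _ => iK; pose A := gen (fun z => In z l \/ Phi H z).
have hA : subgroup Gd A by apply: gen_subgroup.
have hK : subgroup Gd K by apply: gen_subgroup.
have Hx : H x by apply: lH; left.
have lH' z : In z l -> H z by move=> lz; apply: lH; right.
have AH z : A z -> H z by apply: gen_min => // w [|/Phi_sub]; [apply: lH'|].
have AK z : A z -> K z.
  by apply: gen_mono => w [lw|]; [left; right|right].
have Kx : K x by apply: gen_in; left; left.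
have PA z : Phi H z -> A z by move=> h; apply: gen_in; right.
have [Ax|nAx] := classic (A x).
  apply: (IH k) => //; rewrite -/A -(@pred_ext _ K A) // => z; split; last exact: AK.
  apply: gen_min => // w [[<-//|lw]|]; last exact: PA.
  by apply: gen_in; left.
apply: (IH (S k)) => //; rewrite /= Nat.mul_comm; apply: (pstep_index hG hp (x := x)) iK.
(* The conjugate is [m] times the commutator of [m] and [x], which lies in [Phi H]. *)
have conj m : A m -> A (inv x ** m ** x).
  move=> Am; have := subM hA Am (PA _ (Phi_commutator (AH _ Am) Hx)).
  by rewrite /commutator /= !gE.
have Axp : A (pow x p) by apply: PA; apply: Phi_pow.
do 7!split=> //.
apply: gen_min; first exact: pow_cosets_subgroup hA conj Axp.
move=> z hz; have [->|Az] : z = x \/ A z.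
  case: hz => [[->|lz]|hz]; [by left|right..]; [by apply: gen_in; left|exact: PA].
- by exists 1%nat; rewrite /= !gE; apply: sub1 hA.
- by exists O; rewrite /= !gE.
Qed.

(* Burnside's basis theorem for the [p]-group [H / N]. *)
Lemma frattini_nongen N (l : list T) : pnorm N -> (forall x, N x -> H x) ->
  (forall x, In x l -> H x) ->
  (forall x, H x -> gen (fun z => In z l \/ Phi H z) x) ->
  forall x, H x -> gen (fun z => In z l \/ N z) x.
Proof.
move=> [hN [k iN]] NH lH Hgen; pose A := gen (fun z => In z l \/ N z).
have hA : subgroup Gd A by apply: gen_subgroup.
have NA z : N z -> A z by move=> h; apply: gen_in; right.
have AH z : A z -> H z by apply: gen_min => // w []; [apply: lH|apply: NH].
apply: NNPP => nHA.
have [M [hM [AM [MH [[y [Hy nMy]] [st com]]]]]] :=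
  CosetAction.maximal_overgroup hG hp hN iN hA hH NA AH nHA.
(* [M] contains [l], all commutators of [H] and all [p]-th powers, hence all of [H]; this
   contradicts the choice of [y]. *)
apply: nMy; move/Hgen: Hy; apply: gen_min => // z [lz|].
  by apply: AM; apply: gen_in; left.
apply: Phi_min => // a Ha; have [Ma|nMa] := classic (M a); first exact: pow_sub.
by have [_ [_ [_ [_ [_ []]]]]] := st a Ha nMa.
Qed.

End Frattini.

Lemma Phi_normal H : normal Gd H -> normal Gd (Phi H).
Proof.
move=> hH; have hHs := normal_subgroup hH; have hP := Phi_subgroup H.
split=> // g h _; apply: (@Phi_min _ (fun h => Phi H (inv g ** h ** g))).
- split=> //; split; first by rewrite !gE; apply: sub1 hP.
  split=> [u v hu hv|u hu]; first by have := subM hP hu hv; rewrite /= !gE.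
  by have := subV hP hu; rewrite /= !gE.
- move=> a b Ha Hb.
  have := Phi_commutator (normal_conj g hH Ha) (normal_conj g hH Hb).
  by rewrite /commutator /= !gE.
- by move=> a Ha; rewrite -powJ //; apply: Phi_pow; apply: (normal_conj _ hH).
Qed.

(** Schreier from the whole group down to [H], relative to the trivial subgroup, shows that [H] is
    finitely generated. *)
Lemma genp_finite H : fin_gen Gd -> pnorm H ->
  exists l : list T, forall x, H x <-> gen (fun z => In z l \/ Phi H z) x.
Proof.
move=> [n [l0 [_ [_ l0gen]]]] [hH [k iH]]; have hHs := normal_subgroup hH.
have h1 : normal Gd (fun x => x = one).
  split; last by move=> g h _ ->; rewrite /= !gE.
  by do !split=> //; [move=> x y -> ->|move=> x ->]; rewrite /= !gE.
have [|||l [lgen _]] := schreier (l := l0) hH iH h1 _ subgroupT _ indexT.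
- by move=> x ->; apply: sub1 hHs.
- by [].
- move=> x; split=> // _; have /(tgen_discrete hG) := proj1 (l0gen x) I.
  by apply: gen_mono => z lz; left.
exists l => x; split.
  move/lgen; apply: gen_mono => z [|->]; first by left.
  by right; apply: sub1 (Phi_subgroup H).
apply: gen_min => // z [lz|]; last exact: Phi_sub.
by apply/lgen; apply: gen_in; left.
Qed.

Lemma pnorm_Phi H : fin_gen Gd -> pnorm H -> pnorm (Phi H).
Proof.
move=> fg hH; have [l lgen] := genp_finite fg hH; have [nH [k iH]] := hH.
split; first exact: Phi_normal.
apply: (@gen_Phi_index _ (normal_subgroup nH) l k).
  by move=> x lx; apply/lgen; apply: gen_in; left.
by rewrite -(pred_ext lgen).
Qed.

End PPowerIndex.

(** * The pro-p completion *)

Section Completion.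
Variables (T : Type) (mul : T -> T -> T) (inv : T -> T) (one : T).
Hypothesis hG : is_group mul inv one.
Local Infix "**" := mul (at level 40, left associativity).
Local Notation Gd := (discrete mul inv one).
Local Notation gE := (gE hG).
Local Notation sub1 := (@sub1 _ mul inv one _).
Local Notation subM := (@subM _ mul inv one _ _ _).
Local Notation subV := (@subV _ mul inv one _ _).
Local Notation gen_in := (@gen_in _ mul inv one _ _).
Local Notation gen_min := (@gen_min _ mul inv one _ _).
Local Notation gen_mono := (@gen_mono _ mul inv one _ _).
Local Notation normal_conj := (@normal_conj _ mul inv one _).
Variable p : nat.
Hypothesis hp : prime (Z.of_nat p).
Local Notation pnorm := (pnorm mul inv one p).
Local Notation pnormal := (pnormal mul inv one p).
Local Notation Gp := (pro_p_completion mul inv one p).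
Local Notation "f ⋅ g" := (gmul Gp f g) (at level 40, left associativity).
Local Notation "f ^-" := (ginv Gp f) (at level 2, format "f ^-").
Local Notation carr N := (proj1_sig (N : pnormal)).
Local Notation Phi := (PhiP Gd p).

Lemma pnormalP (N : pnormal) : pnorm (carr N). Proof. exact: proj2_sig. Qed.
Lemma pnormal_normal (N : pnormal) : normal Gd (carr N). Proof. by case: (pnormalP N). Qed.
Lemma pnormal_subgroup (N : pnormal) : subgroup Gd (carr N).
Proof. exact: (normal_subgroup (pnormal_normal N)). Qed.

Definition pnormalI (M N : pnormal) : pnormal :=
  exist _ _ (pnorm_inter hG hp (pnormalP M) (pnormalP N)).

Lemma pnormT : pnorm (fun _ => True).
Proof. by split=> //; exists O; apply: indexT. Qed.

(** * Coset representatives and the operations of the completion *)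

(** Identities in the completion are checked level by level on such representatives, where they
    become identities modulo [N]. *)
Definition rep (f : Gp) (N : pnormal) (g : T) := forall z, f N z <-> carr N (inv g ** z).

Lemma rep_ex f N : gset Gp f -> exists g, rep f N g. Proof. by case=> h _; apply: h. Qed.

Lemma rep_eq f N a b : rep f N a -> rep f N b -> carr N (inv a ** b).
Proof.
move=> ha hb; apply/ha/hb; rewrite !gE; exact: sub1 (pnormal_subgroup N).
Qed.

Lemma rep_trans f N a b : rep f N a -> carr N (inv a ** b) -> rep f N b.
Proof.
have hN := pnormal_subgroup N; move=> ha hab z; split=> [/ha haz|hbz].
  exact: (subD hG hN hab haz).
by apply/ha; have := subM hN hab hbz; rewrite !gE.
Qed.

Lemma rep_in f N a z : rep f N a -> f N z -> rep f N z.
Proof. by move=> ha /ha; apply: rep_trans. Qed.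

Lemma rep_self f N a : rep f N a -> f N a.
Proof. by move=> ha; apply/ha; rewrite !gE; apply: sub1 (pnormal_subgroup N). Qed.

Lemma rep_mul f g N a b : rep f N a -> rep g N b -> rep (f ⋅ g) N (a ** b).
Proof.
have hN := pnormal_subgroup N; have nN := pnormal_normal N.
move=> ha hb z; split=> [[a' [b' [/ha Na' [/hb Nb' ->]]]]|h].
  by have := subM hN (normal_conj b nN Na') Nb'; rewrite !gE.
exists a, (inv a ** z); split; first exact: rep_self.
by split; [apply/hb; move: h|]; rewrite !gE.
Qed.

Lemma rep_inv f N a : rep f N a -> rep f^- N (inv a).
Proof.
have hN := pnormal_subgroup N; have nN := pnormal_normal N.
move=> ha z; split=> [/ha h|h].
  by apply: (normal_swap hG nN); have := subV hN h; rewrite !gE.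
by apply/ha; have := subV hN (normal_swap hG nN h); rewrite !gE.
Qed.

Lemma rep_one N : rep (gone Gp) N one.
Proof. by move=> z; rewrite !gE. Qed.

Lemma rep_pow f N a n : rep f N a -> rep (gpow Gp f n) N (gpow Gd a n).
Proof. by move=> h; elim: n => [|n IH] /=; [apply: rep_one|apply: rep_mul]. Qed.

Lemma rep_commutator f g N a b : rep f N a -> rep g N b ->
  rep (commutator Gp f g) N (commutator Gd a b).
Proof. by move=> ha hb; do !(apply: rep_mul || apply: rep_inv). Qed.

Lemma rep_mono f (M N : pnormal) a : gset Gp f -> (forall x, carr M x -> carr N x) ->
  rep f M a -> rep f N a.
Proof.
move=> hf MN ha; have [b hb] := rep_ex N hf; apply: rep_in hb _.
by apply: (proj2 hf _ _ MN); apply: rep_self.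
Qed.

Lemma rep_ext f g : gset Gp f -> gset Gp g -> (forall N a, rep f N a -> rep g N a) -> f = g.
Proof.
move=> hf hg h; apply: functional_extensionality => N; apply: pred_ext => z.
by have [a ha] := rep_ex N hf; split=> [/ha /(h _ _ ha)|/(h _ _ ha) /ha].
Qed.

Lemma gset_of_rep f : (forall N, exists g, rep f N g) ->
  (forall M N : pnormal, (forall x, carr M x -> carr N x) ->
     forall a b, rep f M a -> rep f N b -> carr N (inv b ** a)) -> gset Gp f.
Proof.
move=> ex compat; split=> // M N MN z fMz; have [a ha] := ex M; have [b hb] := ex N.
by apply/hb; apply: (compat M N MN _ _ (rep_in ha fMz) hb).
Qed.

Lemma gset_mul f g : gset Gp f -> gset Gp g -> gset Gp (f ⋅ g).
Proof.
move=> hf hg; apply: gset_of_rep => [N|M N MN a b ha hb].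
  have [a ha] := rep_ex N hf; have [b hb] := rep_ex N hg.
  by exists (a ** b); apply: rep_mul.
have [c hc] := rep_ex M hf; have [d hd] := rep_ex M hg.
have h1 := rep_mul (rep_mono hf MN hc) (rep_mono hg MN hd).
have := subM (pnormal_subgroup N) (rep_eq hb h1) (MN _ (rep_eq (rep_mul hc hd) ha)).
by rewrite !gE.
Qed.

Lemma gset_inv f : gset Gp f -> gset Gp f^-.
Proof.
move=> hf; apply: gset_of_rep => [N|M N MN a b ha hb].
  by have [a ha] := rep_ex N hf; exists (inv a); apply: rep_inv.
have [c hc] := rep_ex M hf.
have := subM (pnormal_subgroup N) (rep_eq hb (rep_inv (rep_mono hf MN hc)))
  (MN _ (rep_eq (rep_inv hc) ha)).
by rewrite !gE.
Qed.

Lemma gset_one : gset Gp (gone Gp).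
Proof.
split=> [N|M N MN z]; last exact: MN.
by exists one; apply: rep_one.
Qed.

Lemma subgroup_gset : subgroup Gp (gset Gp).
Proof.
split=> //; split; first exact: gset_one.
by split=> [f g|f]; [apply: gset_mul|apply: gset_inv].
Qed.

Lemma gp_sub1 K : subgroup Gp K -> K (gone Gp). Proof. by case=> _ []. Qed.
Lemma gp_subM K f g : subgroup Gp K -> K f -> K g -> K (f ⋅ g).
Proof. by move=> [_ [_ [h _]]]; apply: h. Qed.
Lemma gp_subV K f : subgroup Gp K -> K f -> K f^-.
Proof. by move=> [_ [_ [_ h]]]; apply: h. Qed.
Lemma gp_subset K f : subgroup Gp K -> K f -> gset Gp f.
Proof. by case=> h _; apply: h. Qed.

Lemma gp_subX K f n : subgroup Gp K -> K f -> K (gpow Gp f n).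
Proof. by move=> hK Kf; elim: n => [|n IH] /=; [apply: gp_sub1|apply: gp_subM]. Qed.
Lemma gp_subR K f g : subgroup Gp K -> K f -> K g -> K (commutator Gp f g).
Proof. by move=> hK Kf Kg; do !(apply: gp_subM || apply: gp_subV). Qed.

(** * The dense image of the group, basic open subgroups and closures *)

(** The canonical map to the completion; it need not be injective. *)
Definition iota (g : T) : Gp := fun N z => carr N (inv g ** z).

Lemma rep_iota g N : rep (iota g) N g. Proof. by []. Qed.

Lemma gset_iota g : gset Gp (iota g).
Proof. by split=> [N|M N MN z]; [exists g|apply: MN]. Qed.

Lemma iotaM a b : iota (a ** b) = iota a ⋅ iota b.
Proof.
apply: rep_ext; [exact: gset_iota|by apply: gset_mul; apply: gset_iota|].
move=> N c /(rep_eq (rep_iota _ _)); apply: rep_trans.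
by apply: rep_mul.
Qed.

Lemma iotaV a : iota (inv a) = (iota a)^-.
Proof.
apply: rep_ext; [exact: gset_iota|by apply: gset_inv; apply: gset_iota|].
move=> N c /(rep_eq (rep_iota _ _)); apply: rep_trans.
exact: rep_inv.
Qed.

Lemma iota1 : iota one = gone Gp.
Proof.
apply: rep_ext; [exact: gset_iota|exact: gset_one|].
move=> N c /(rep_eq (rep_iota _ _)); apply: rep_trans; exact: rep_one.
Qed.

Definition close (N : pnormal) (f g : Gp) := exists a, rep f N a /\ rep g N a.

Lemma close_trans N f g h : close N f g -> close N g h -> close N f h.
Proof.
move=> [a [fa ga]] [b [gb hb]]; exists b; split=> //.
exact: rep_trans fa (rep_eq ga gb).
Qed.

Lemma close_mono (M N : pnormal) f g : gset Gp f -> gset Gp g ->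
  (forall x, carr M x -> carr N x) -> close M f g -> close N f g.
Proof. by move=> hf hg MN [a [ha hb]]; exists a; split; apply: (rep_mono _ MN). Qed.

(* The closure of [N] in the completion. *)
Definition hat (N : pnormal) (f : Gp) : Prop :=
  gset Gp f /\ forall z, f N z <-> carr N z.

Lemma hat_rep f N a : gset Gp f -> rep f N a -> (hat N f <-> carr N a).
Proof.
move=> hf ha; split=> [[_ h]|Na]; first by apply/h; apply: rep_self.
split=> // z; have := rep_trans ha (b := one); rewrite !gE => h.
by have := h (subV (pnormal_subgroup N) Na) z; rewrite !gE.
Qed.

Lemma hat_div f g N : gset Gp f -> gset Gp g -> (hat N (f^- ⋅ g) <-> close N f g).
Proof.
move=> hf hg; have [a ha] := rep_ex N hf; have [b hb] := rep_ex N hg.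
have hfg : gset Gp (f^- ⋅ g) by apply: gset_mul => //; apply: gset_inv.
have E := hat_rep hfg (rep_mul (rep_inv ha) hb).
split=> [/E h|[c [fc gc]]]; first by exists b; split=> //; apply: rep_trans ha h.
apply/E; have := subM (pnormal_subgroup N) (rep_eq ha fc) (rep_eq gc hb).
by rewrite !gE.
Qed.

Lemma hat_subgroup N : subgroup Gp (hat N).
Proof.
have hN := pnormal_subgroup N.
split; first by move=> f [].
split; first by apply/(hat_rep gset_one (rep_one N)); apply: sub1 hN.
split=> [f g hf hg|f hf].
  have [sf sg] := (proj1 hf, proj1 hg).
  have [a ha] := rep_ex N sf; have [b hb] := rep_ex N sg.
  apply/(hat_rep (gset_mul sf sg) (rep_mul ha hb)).
  by apply: subM => //; [apply/(hat_rep sf ha)|apply/(hat_rep sg hb)].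
have sf := proj1 hf; have [a ha] := rep_ex N sf.
apply/(hat_rep (gset_inv sf) (rep_inv ha)).
by apply: subV => //; apply/(hat_rep sf ha).
Qed.

Lemma hat_normal N : normal Gp (hat N).
Proof.
split; first exact: hat_subgroup.
move=> g h sg hh; have sh := proj1 hh.
have [a ha] := rep_ex N sg; have [b hb] := rep_ex N sh.
have sgh : gset Gp (g^- ⋅ h ⋅ g) by do !apply: gset_mul => //; apply: gset_inv.
apply/(hat_rep sgh (rep_mul (rep_mul (rep_inv ha) hb) ha)).
by apply: (normal_conj _ (pnormal_normal N)); apply/(hat_rep sh hb).
Qed.

Lemma hat_mono (M N : pnormal) : (forall x, carr M x -> carr N x) ->
  forall f, hat M f -> hat N f.
Proof.
move=> MN f hf; have sf := proj1 hf; have [a ha] := rep_ex M sf.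
by apply/(hat_rep sf (rep_mono sf MN ha))/MN/(hat_rep sf ha).
Qed.

Lemma hat_iota N g : hat N (iota g) <-> carr N g.
Proof. exact: hat_rep (gset_iota g) (rep_iota g N). Qed.

(** The basic neighbourhoods are exactly the subgroups [hat N], so approximation in the topology is
    agreement at each level. *)
Lemma closP (A : Gp -> Prop) f : (forall s, A s -> gset Gp s) ->
  clos Gp A f <-> gset Gp f /\ forall N, exists s, A s /\ close N s f.
Proof.
move=> hA; split=> -[sf h]; split=> //; [move=> N|move=> U [N UE]].
  have hU : gnbhd Gp (hat N) by exists N.
  have [s [As hs]] := h _ hU.
  by exists s; split=> //; apply/hat_div => //; apply: hA.
have [s [As hs]] := h N; exists s; split=> //.
by apply/UE/hat_div => //; apply: hA.
Qed.

Lemma gp_gen_gset (A : Gp -> Prop) f : (forall s, A s -> gset Gp s) -> gen Gp A f -> gset Gp f.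
Proof. by move=> hA; apply=> //; apply: subgroup_gset. Qed.

Definition closed (K : Gp -> Prop) := forall f, clos Gp K f -> K f.

(** Closure is idempotent because [close] is transitive. Any subgroup with a value of [d] or [d_p]
    is of this form, so the gradients of the completion see closed subgroups only. *)
Lemma tgen_closed (K A : Gp -> Prop) : (forall f, A f -> gset Gp f) ->
  (forall f, K f <-> tgen Gp A f) -> closed K.
Proof.
move=> hA KE f.
have hgA s : gen Gp A s -> gset Gp s by apply: gp_gen_gset.
have hK s : K s -> gset Gp s by move/KE => [].
move/(closP _ hK) => [sf h]; apply/KE/(closP _ hgA); split=> // N.
have [s [/KE /(closP _ hgA) [_ /(_ N) [t [At ts]]] sf']] := h N.
by exists t; split=> //; apply: close_trans ts sf'.
Qed.

Lemma tgen_min (K A : Gp -> Prop) : subgroup Gp K -> closed K -> (forall f, A f -> K f) ->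
  forall f, tgen Gp A f -> K f.
Proof.
move=> hK cK AK f [sf h]; apply: cK; split=> // U /h [s [As Us]]; exists s; split=> //.
exact: As.
Qed.

Lemma hat_closed N : closed (hat N).
Proof.
move=> f /closP h; have [|sf /(_ N) [s [hs [a [sa fa]]]]] := h; first by move=> s [].
by apply/(hat_rep sf fa)/(hat_rep (proj1 hs) sa).
Qed.

(* Modulo [F], topological generation becomes abstract generation. *)
Lemma tgen_approx (F : pnormal) (A : Gp -> Prop) (B : T -> Prop) :
  (forall f, A f -> gset Gp f) -> subgroup Gd B -> (forall x, carr F x -> B x) ->
  (forall f a, A f -> rep f F a -> B a) ->
  forall f a, tgen Gp A f -> rep f F a -> B a.
Proof.
move=> hA hB FB AB f a.
have FBt x y : B x -> carr F (inv x ** y) -> B y.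
  by move=> Bx /FB /(subM hB Bx); rewrite !gE.
have genB s : gen Gp A s -> gset Gp s /\ forall a, rep s F a -> B a.
  move/(_ (fun s => gset Gp s /\ forall a, rep s F a -> B a)); apply;
    last by move=> g Ag; split=> [|b hb]; [apply: hA|apply: (AB g)].
  split; first by move=> g [].
  split.
    split; first exact: gset_one.
    by move=> b /(rep_eq (rep_one F)); apply: FBt; exact: sub1 hB.
  split=> [g h [sg Bg] [sh Bh]|g [sg Bg]].
    split=> [|c hc]; first exact: gset_mul.
    have [b hb] := rep_ex F sg; have [d hd] := rep_ex F sh.
    by apply: FBt (rep_eq (rep_mul hb hd) hc); apply: subM hB (Bg _ hb) (Bh _ hd).
  split=> [|c hc]; first exact: gset_inv.
  have [b hb] := rep_ex F sg.
  by apply: FBt (rep_eq (rep_inv hb) hc); apply: subV hB (Bg _ hb).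
move=> /closP h ha; have [|sf /(_ F) [s [/genB [_ Bs] [b [sb fb]]]]] := h.
  by move=> s /genB [].
by apply: FBt (rep_eq fb ha); apply: Bs.
Qed.

(** As [N] is normal, the products of an element of [gen A] by one of [N] form a subgroup. *)
Lemma gen_modulo (A N : T -> Prop) g : normal Gd N ->
  gen Gd (fun z => A z \/ N z) g -> exists s, gen Gd A s /\ N (inv s ** g).
Proof.
move=> nN; have hN := normal_subgroup nN; have hA := @gen_subgroup _ mul inv one A.
move/(_ (fun g => exists s, gen Gd A s /\ N (inv s ** g))); apply.
  split=> //; split; first by exists one; split; [apply: sub1 hA|rewrite !gE; apply: sub1 hN].
  split=> [x y [s [As hs]] [t [At ht]]|x [s [As hs]]].
    exists (s ** t); split; first exact: (subM hA As At).
    by have := subM hN (normal_conj t nN hs) ht; rewrite /= !gE.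
  exists (inv s); split; first exact: (subV hA As).
  have h := subV hN hs; apply: (normal_swap hG nN); move: h; by rewrite /= !gE.
move=> z [Az|Nz].
  by exists z; split; [apply: gen_in|rewrite !gE; apply: sub1 hN].
by exists one; split; [apply: sub1 hA|rewrite !gE].
Qed.

Lemma iota_gen (l : list T) s : gen Gd (fun z => In z l) s ->
  gen Gp (fun f => In f (map iota l)) (iota s).
Proof.
move=> hs S hS lS; move: hs.
move/(_ (fun s => S (iota s))); apply.
  split=> //; split; first by rewrite /= iota1; apply: gp_sub1.
  split=> [x y hx hy|x hx] /=; first by rewrite iotaM; apply: gp_subM.
  by rewrite iotaV; apply: gp_subV.
by move=> x lx; apply: lS; apply: in_map.
Qed.

(** * Numbers of generators of [H] and of its closure *)

(** By the Frattini argument the list generates [H] modulo every level inside [H], so its image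
    generates a dense subgroup of [hat H]. *)
Lemma genp_gen_hat (H : pnormal) m :
  genp_by Gd p (carr H) m -> gen_by Gp (hat H) m.
Proof.
have hH := pnormal_subgroup H.
move=> [l [lm [lH lE]]]; exists (map iota l); split; first by rewrite length_map.
have lhat f : In f (map iota l) -> hat H f.
  by move=> /in_map_iff [x [<- lx]]; apply/hat_iota/lH.
split=> // f; split; last first.
  by apply: (tgen_min (hat_subgroup H) (@hat_closed H)).
move=> hf; have sf := proj1 hf; split=> // U [N UE].
(* The Frattini argument needs a level contained in [H], hence the intersection. *)
pose NH := pnormalI N H.
have NN x : carr NH x -> carr N x by case.
have NHH x : carr NH x -> carr H x by case.
have [g hg] := rep_ex NH sf.
have Hg : carr H g by apply/(hat_rep sf (rep_mono sf NHH hg)).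
have lPhi x : carr H x -> gen Gd (fun z => In z l \/ Phi (carr H) z) x.
  by move/lE/(tgen_discrete hG).
have gl := frattini_nongen hG hp hH (pnormalP NH) NHH lH lPhi Hg.
have [s [ls hs]] := gen_modulo (pnormal_normal NH) gl.
exists (iota s); split; first exact: iota_gen.
apply/UE/(hat_div N (gset_iota s) sf); exists g; split; last exact: rep_mono sf NN hg.
by apply: rep_trans (rep_iota s N) (NN _ hs).
Qed.

Lemma Phi_gset p' K f : PhiP Gp p' K f -> gset Gp f. Proof. by case. Qed.

Lemma gen_genp_hat (H : pnormal) m : gen_by Gp (hat H) m -> genp_by Gp p (hat H) m.
Proof.
have hH := hat_subgroup H.
move=> [l [lm [lH lE]]]; exists l; split=> //; split=> // f; split.
  move/lE => [sf h]; split=> // U /h [s [ls Us]]; exists s; split=> // S hS AS.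
  by apply: ls => // a la; apply: AS; left.
apply: (tgen_min hH (@hat_closed H)) => a [|]; first exact: lH.
apply: (tgen_min hH (@hat_closed H)) => b [[x [y [Hx [Hy ->]]]]|[x [Hx ->]]].
  exact: gp_subR.
exact: gp_subX.
Qed.

Definition repr (F : pnormal) (f : Gp) : T := epsilon (inhabits one) (rep f F).

Lemma reprP F f : gset Gp f -> rep f F (repr F f).
Proof. by move=> sf; apply: epsilon_spec; apply: rep_ex. Qed.

(** [P] collects generators that vanish modulo [F]: the Frattini part when [d_p] is compared,
    nothing when an open subgroup is approximated. *)
Lemma gen_repr (F : pnormal) (l : list Gp) (K : Gp -> Prop) (P : Gp -> Prop) :
  (forall f, In f l \/ P f -> gset Gp f) ->
  (forall f a, P f -> rep f F a -> carr F a) ->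
  (forall f, K f -> tgen Gp (fun y => In y l \/ P y) f) ->
  forall g, K (iota g) -> gen Gd (fun z => In z (map (repr F) l) \/ carr F z) g.
Proof.
move=> hA hP hK g /hK hg; set B := gen Gd _.
have hB : subgroup Gd B by apply: gen_subgroup.
have FB x : carr F x -> B x by move=> Fx; apply: gen_in; right.
apply: (tgen_approx hA hB FB _ hg (rep_iota g F)) => f a [lf|Pf] ha;
  last by apply: FB; apply: (hP f).
have sf : gset Gp f by apply: hA; left.
have Br : B (repr F f) by apply: gen_in; left; apply: in_map.
by have := subM hB Br (FB _ (rep_eq (reprP F sf) ha)); rewrite !gE.
Qed.

Hypothesis fgG : fin_gen Gd.

Definition pnormalPhi (H : pnormal) : pnormal :=
  exist _ _ (pnorm_Phi hG hp fgG (pnormalP H)).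

Lemma pnormalPhi_sub (H : pnormal) x : carr (pnormalPhi H) x -> carr H x.
Proof. exact: (Phi_sub hG (pnormal_subgroup H)). Qed.

(** Modulo [F], commutators and [p]-th powers from [hat H] are represented by those from [H], and
    [tgen_approx] carries this over to the closure. *)
Lemma PhiP_hat_rep (H : pnormal) f a :
  PhiP Gp p (hat H) f -> rep f (pnormalPhi H) a -> Phi (carr H) a.
Proof.
have hH := hat_subgroup H; set F := pnormalPhi H.
have rH f' : hat H f' -> exists b, rep f' F b /\ carr H b.
  move=> hf; have sf := proj1 hf; have [b hb] := rep_ex F sf; exists b; split=> //.
  by apply/(hat_rep sf (rep_mono sf (@pnormalPhi_sub H) hb)).
apply: tgen_approx => //.
- move=> f' [[x [y [Hx [Hy ->]]]]|[x [Hx ->]]]; apply: (gp_subset hH).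
    exact: gp_subR.
  exact: gp_subX.
- exact: Phi_subgroup.
- move=> f' c [[x [y [/rH [b [hb Hb]] [/rH [d [hd Hd]] ->]]]]|[x [/rH [b [hb Hb]] ->]]] hc.
    have := rep_eq (rep_commutator hb hd) hc.
    move/(subM (Phi_subgroup hG p _) (Phi_commutator hG p Hb Hd)).
    by rewrite (gmulKVl hG).
  have := rep_eq (rep_pow p hb) hc.
  move/(subM (Phi_subgroup hG p _) (Phi_pow hG p Hb)).
  by rewrite (gmulKVl hG).
Qed.

(** Representatives are taken modulo [[H,H] H^p] itself, so the error of approximation is absorbed
    by the subgroup already adjoined. *)
Lemma genp_hat_genp (H : pnormal) m :
  genp_by Gp p (hat H) m -> genp_by Gd p (carr H) m.
Proof.
have hH := pnormal_subgroup H; set F := pnormalPhi H.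
move=> [l [lm [lH lE]]]; exists (map (repr F) l); split; first by rewrite length_map.
have lH' x : In x (map (repr F) l) -> carr H x.
  move=> /in_map_iff [f [<- /lH hf]]; have sf := proj1 hf.
  by apply/(hat_rep sf (rep_mono sf (@pnormalPhi_sub H) (reprP F sf))).
split=> // x; rewrite (tgen_discrete hG); split; last first.
  by apply: gen_min => // z []; [apply: lH'|apply: (Phi_sub hG)].
move=> /hat_iota; apply: (gen_repr (F := F) (P := PhiP Gp p (hat H))) =>
   [f [/lH []|/Phi_gset]|f a|f /lE] //.
exact: PhiP_hat_rep.
Qed.

(** Generation of [H] modulo [Phi H], of [hat H], and of [hat H] modulo its own Frattini part imply
    one another in a cycle. *)
Lemma genp_hat (H : pnormal) m : genp_by Gp p (hat H) m <-> genp_by Gd p (carr H) m.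
Proof.
by split; [apply: genp_hat_genp|move/genp_gen_hat; apply: gen_genp_hat].
Qed.

Lemma gen_hat (H : pnormal) m : gen_by Gp (hat H) m <-> genp_by Gp p (hat H) m.
Proof.
by split; [apply: gen_genp_hat|move/genp_hat_genp; apply: genp_gen_hat].
Qed.

Lemma dp_hat (H : pnormal) n : dp_is Gp p (hat H) n <-> dp_is Gd p (carr H) n.
Proof.
by split=> -[h1 h2]; split; try exact/genp_hat; move=> m /genp_hat; apply: h2.
Qed.

Lemma d_hat (H : pnormal) n : d_is Gp (hat H) n <-> dp_is Gp p (hat H) n.
Proof.
by split=> -[h1 h2]; split; try exact/gen_hat; move=> m /gen_hat; apply: h2.
Qed.

(** * Closed subgroups of finite index are open *)

Lemma gp_mulK f g : gset Gp f -> gset Gp g -> f ⋅ (f^- ⋅ g) = g.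
Proof.
move=> sf sg; apply: rep_ext => // [|N c].
  by apply: gset_mul => //; apply: gset_mul => //; apply: gset_inv.
have [a ha] := rep_ex N sf; have [b hb] := rep_ex N sg.
move/(rep_eq (rep_mul ha (rep_mul (rep_inv ha) hb))).
by rewrite (gmulKVl hG); apply: rep_trans.
Qed.

Lemma subgroup_close (K : Gp -> Prop) N f g : subgroup Gp K ->
  (forall h, hat N h -> K h) -> gset Gp g -> K f -> close N f g -> K g.
Proof.
move=> hK NK sg Kf fg; have sf := gp_subset hK Kf; rewrite -(gp_mulK sf sg).
by apply: gp_subM => //; apply/NK/hat_div.
Qed.

Lemma common_pnormal (P : nat -> pnormal -> Prop) n :
  (forall i (M N : pnormal), (forall x, carr M x -> carr N x) -> P i N -> P i M) ->
  (forall i, (i < n)%nat -> exists N, P i N) ->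
  exists N, forall i, (i < n)%nat -> P i N.
Proof.
move=> mono; elim: n => [|n IH] ex; first by exists (exist _ _ pnormT); lia.
have [|M hM] := IH; first by move=> i lti; apply: ex; lia.
have [|N hN] := ex n; first by lia.
exists (pnormalI M N) => i lti; have [->|lt] : i = n \/ (i < n)%nat by lia.
  by apply: mono hN => x [].
by apply: mono (hM i lt) => x [].
Qed.

(** Each representative outside the closed [K] is separated from [K] at some level; the intersection
    of these finitely many levels is the required [N]. *)
Lemma closed_open (K : Gp -> Prop) i : subgroup Gp K -> closed K -> index Gp K i ->
  exists N, forall f, hat N f -> K f.
Proof.
move=> hK cK /index_fun [r [rG [_ rsurj]]].
have [|a lta|N hN] := @common_pnormal
  (fun a N => K (r a) \/ forall s, K s -> gset Gp (r a) -> ~ close N s (r a)) i.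
- move=> a M N MN [Kr|h]; [by left|right] => s Ks sr; have ss := gp_subset hK Ks.
  by move/(close_mono ss sr MN); apply: h.
- have [Kr|nKr] := classic (K (r a)); first by exists (exist _ _ pnormT); left.
  apply: NNPP => no; apply: nKr; apply: cK; apply/closP; first by move=> s; apply: gp_subset.
  split=> [|N]; first exact: rG.
  apply: NNPP => no'; apply: no; exists N; right=> s Ks _ c; apply: no'; by exists s.
exists N => f hf; have sf := proj1 hf; have [a [lta Ka]] := rsurj f sf.
have sr := rG a lta; have [Kr|nc] := hN a lta.
  by rewrite -(gp_mulK sr sf); apply: gp_subM.
(* The inverse of [(r a)^-1 f] lies in [K] and is [f^-1 (r a)], which agrees with [r a] at level [N]
   because [f] is in [hat N]. *)
case: (nc _ (gp_subV hK Ka) sr); have [b hb] := rep_ex N sr; exists b; split=> //.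
have [c hc] := rep_ex N sf; have Nc : carr N c by apply/(hat_rep sf hc).
apply: rep_trans (rep_inv (rep_mul (rep_inv hb) hc)) _; rewrite !gE.
have := normal_conjV hG (inv b) (pnormal_normal N) Nc.
by have := normal_swap hG (pnormal_normal N) (x := c) (y := one); rewrite !gE.
Qed.

(** * Open subgroups and their traces on the group *)

Section Trace.
Variables (K : Gp -> Prop) (N : pnormal).
Hypothesis hK : subgroup Gp K.
Hypothesis NK : forall f, hat N f -> K f.

Definition trace (g : T) : Prop := K (iota g).

Lemma trace_subgroup : subgroup Gd trace.
Proof.
split=> //; split; first by rewrite /trace /= iota1; apply: gp_sub1.
split=> [x y hx hy|x hx]; rewrite /trace /=; first by rewrite iotaM; apply: gp_subM.
by rewrite iotaV; apply: gp_subV.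
Qed.

(** Since [hat N] lies in [K], membership in [K] depends only on the component at [N]. *)
Lemma trace_rep f g : gset Gp f -> rep f N g -> (K f <-> trace g).
Proof.
move=> sf fg; split=> h; apply: (subgroup_close hK NK) h _ => //; try exact: gset_iota.
  by exists g.
by exists g.
Qed.

Lemma sub_trace x : carr N x -> trace x.
Proof. by move=> Nx; apply/NK/hat_iota. Qed.

Lemma index_trace i : index Gp K i -> index Gd trace i.
Proof.
move=> /index_fun [r [rG [rinj rsurj]]]; apply/index_fun.
exists (fun a => repr N (r a)); split=> //; split=> [a b lta ltb|g _].
  have [sa sb] := (rG a lta, rG b ltb).
  move/(trace_rep (gset_mul (gset_inv sa) sb) (rep_mul (rep_inv (reprP N sa)) (reprP N sb))).
  exact: rinj.
have [a [lta Ka]] := rsurj _ (gset_iota g); have sa := rG a lta; exists a; split=> //.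
apply/(trace_rep (gset_mul (gset_inv sa) (gset_iota g))
  (rep_mul (rep_inv (reprP N sa)) (rep_iota g N))).
exact: Ka.
Qed.

Lemma trace_normal : normal Gp K -> normal Gd trace.
Proof.
move=> [_ nK]; split=> [|g h _ Kh]; first exact: trace_subgroup.
by rewrite /trace /= !iotaM iotaV; apply: nK => //; apply: gset_iota.
Qed.

Lemma hat_trace (H : pnormal) : carr H = trace -> hat H = K.
Proof.
move=> HE; apply: pred_ext => f.
have NH x : carr N x -> carr H x by rewrite HE; apply: sub_trace.
split=> [hf|Kf].
  have sf := proj1 hf; have [g fg] := rep_ex N sf; apply/(trace_rep sf fg).
  by rewrite -HE; apply/(hat_rep sf (rep_mono sf NH fg)).
have sf := gp_subset hK Kf; have [g fg] := rep_ex N sf.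
by apply/(hat_rep sf (rep_mono sf NH fg)); rewrite HE; apply/(trace_rep sf fg).
Qed.

End Trace.

Lemma index_hat (H : pnormal) i : index Gd (carr H) i -> index Gp (hat H) i.
Proof.
move=> /index_fun [r [_ [rinj rsurj]]]; apply/index_fun.
exists (fun a => iota (r a)); split; first by move=> a _; apply: gset_iota.
split=> [a b lta ltb|f sf].
  by rewrite -iotaV -iotaM => /hat_iota; apply: rinj.
have [g fg] := rep_ex H sf; have [a [lta Ha]] := rsurj g I; exists a; split=> //.
by apply/(hat_rep (gset_mul (gset_inv (gset_iota _)) sf) (rep_mul (rep_inv (rep_iota _ _)) fg)).
Qed.

(** * Comparison of the gradients *)

(** The maps [hat] and [trace] match the normal subgroups of [p]-power index on both sides,
    preserving the index and [d_p]. *)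
Lemma RGp_values_eq r : RGp_values Gd p r <-> RGp_values Gp p r.
Proof.
split=> [[H [n [k [nH [iH [dH ->]]]]]]|[K [n [k [nK [iK [dK ->]]]]]]].
  have hH : pnorm H by split=> //; exists k.
  pose H' : pnormal := exist _ _ hH.
  exists (hat H'), n, k; split; first exact: hat_normal.
  by split; [apply: index_hat|split=> //; apply/dp_hat].
have hK := proj1 nK; have sK f : K f -> gset Gp f by apply: gp_subset.
have cK : closed K.
  have [[l [_ [lK lE]]] _] := dK; apply: tgen_closed lE => f [/lK/sK|/Phi_gset] //.
have [N NK] := closed_open hK cK iK.
have iH := index_trace hK NK iK.
have hH : pnorm (trace K) by split; [apply: (trace_normal hK nK)|exists k].
pose H : pnormal := exist _ _ hH.
have HE : hat H = K by apply: (hat_trace hK NK).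
exists (trace K), n, k; split; first exact: (proj1 hH).
by split=> //; split=> //; apply/(dp_hat H); rewrite HE.
Qed.

Lemma RGp_values_RG r : RGp_values Gp p r -> RG_values Gp r.
Proof.
move/RGp_values_eq => [H [n [k [nH [iH [dH ->]]]]]].
have hH : pnorm H by split=> //; exists k.
pose H' : pnormal := exist _ _ hH.
exists (hat H'), n, (Nat.pow p k); split; first exact: hat_subgroup.
by split; [apply: index_hat|split=> //; apply/d_hat/dp_hat].
Qed.

(** Schreier only bounds a number of generators; this supplies the minimum that [dp_is] asks for. *)
Lemma least_nat (P : nat -> Prop) m : P m ->
  exists n, (n <= m)%nat /\ P n /\ forall j, P j -> (n <= j)%nat.
Proof.
elim/(well_founded_ind Nat.lt_wf_0): m => m IH Pm.
have [[j [Pj ltj]]|no] := classic (exists j, P j /\ (j < m)%nat).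
  by have [n [le h]] := IH j ltj Pj; exists n; split=> //; lia.
exists m; split; [lia|split=> // j Pj]; have [//|lt] := Nat.le_gt_cases m j.
by case: no; exists j.
Qed.

Lemma RG_values_RGp r : RG_values Gp r -> exists r', RGp_values Gp p r' /\ (r' <= r)%R.
Proof.
move=> [K [n [i [hK [iK [[[l [ln [lK lE]]] _] ->]]]]]].
have sK f : K f -> gset Gp f by apply: gp_subset.
have sl f : In f l -> gset Gp f by move/lK/sK.
have cK : closed K by apply: tgen_closed lE.
have [N NK] := closed_open hK cK iK; pose F := pnormalPhi N.
have FK f : hat F f -> K f by move/(hat_mono (@pnormalPhi_sub N)); apply: NK.
have hK0 := trace_subgroup hK; have iK0 := index_trace hK NK iK.
have K0E x : trace K x <-> gen Gd (fun z => In z (map (repr F) l) \/ carr F z) x.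
  split.
    apply: (gen_repr (F := F) (P := fun _ => False)); [by move=> f []; auto|by []|].
    move=> f /lE [sf h]; split=> // U /h [s [ls Us]]; exists s; split=> // S hS AS.
    by apply: ls => // a la; apply: AS; left.
  apply: gen_min => // z [/in_map_iff [f [<- lf]]|Fz].
    by apply/(trace_rep hK FK (sl f lf) (reprP F (sl f lf)))/lK.
  exact: (sub_trace FK).
have [nN [k iN]] := pnormalP N.
have [l' [l'E le]] := schreier hG hp nN iN (pnormal_normal F) (@pnormalPhi_sub N)
  hK0 (fun x => @sub_trace K N NK x) iK0 K0E.
(* As [F] is [[N,N] N^p], generating [N] modulo [F] is what [genp_by] requires. *)
have gN : genp_by Gd p (carr N) (length l').
  exists l'; split=> //; split=> [x lx|x]; first by apply/l'E; apply: gen_in; left.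
  by rewrite (tgen_discrete hG).
have [m [lem [gm min]]] := least_nat gN.
exists ((INR m - 1) / INR (Nat.pow p k))%R; split.
  apply/RGp_values_eq; exists (carr N), m, k; do !split=> //.
rewrite length_map ln in le.
have i0 : (0 < INR i)%R by apply/lt_0_INR/(index_gt0 iK0).
have k0 : (0 < INR (Nat.pow p k))%R by apply/lt_0_INR/(index_gt0 iN).
(* This is the wanted inequality of quotients after clearing the denominators [i] and [p ^ k]. *)
have le' : (INR i * INR m + INR (Nat.pow p k) <= INR (Nat.pow p k) * INR n + INR i)%R.
  rewrite -!mult_INR -!plus_INR; apply: le_INR; nia.
apply/Rle_div_l => //; rewrite /Rdiv Rmult_assoc (Rmult_comm (/ _)) -Rmult_assoc.
by apply/Rle_div_r => //; lra.
Qed.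

End Completion.

Theorem theorem2p7 (T : Type) (mul : T -> T -> T) (inv : T -> T) (one : T)
  (p : nat) :
  is_group mul inv one ->
  fin_gen (discrete mul inv one) ->
  prime (Z.of_nat p) ->
  RGp (discrete mul inv one) p = RGp (pro_p_completion mul inv one p) p /\
  RGp (pro_p_completion mul inv one p) p = RG (pro_p_completion mul inv one p).
Proof.
move=> hG fgG hp; split.
  by apply: Glb_Rbar_eqset; apply: RGp_values_eq.
(* One inequality holds since every value for [RG] dominates one for [RGp], the other by inclusion
   of the sets of values. *)
apply: Rbar_le_antisym.
  apply: (proj2 (Glb_Rbar_correct _)) => r /(RG_values_RGp hG hp fgG) [r' [hr' le]].
  exact: Rbar_le_trans (proj1 (Glb_Rbar_correct _) _ hr') _.
apply: is_glb_Rbar_subset (Glb_Rbar_correct _) (Glb_Rbar_correct _).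
exact: RGp_values_RG.
Qed.
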